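(* Let $U,\hat U$ be Hilbert spaces, $Q:U\to\hat U$ a bounded linear operator such that $\gamma(Q)>0$, $w\in\hat U$, $u^{(0)}\in U$, and let $(u^{(n)})_{n\ge0}$ be generated by the steepest-descent recurrence $$r^{(n)}=Q^*(Qu^{(n)}-w),\qquad u^{(n+1)}=u^{(n)}-\alpha_n r^{(n)},\qquad \alpha_n:=\frac{\|r^{(n)}\|^2}{\|Qr^{(n)}\|^2},\qquad n\ge0.$$ Then the error $e^{(n)}:=u^{(n)}-P_{M_{Q,w}}u^{(0)}$ satisfies $$\|e^{(n)}\|\le\kappa\Big(1-\frac{2}{\kappa^2+1}\Big)^{n}\|e^{(0)}\|,\qquad n\ge0,$$ where $\kappa:=\|Q\|/\gamma(Q)$.
   Context: $Q^*$ is the adjoint of $Q$. $M_{Q,w}:=\{u\in U:\|Qu-w\|=\inf_{v\in U}\|Qv-w\|\}$, which is nonempty for every $w$ when $\gamma(Q)>0$; $P_S$ is the orthogonal projection onto a nonempty closed affine subspace $S$. The reduced minimum modulus of $Q$ is $\gamma(Q):=\inf\{\|Qu\|:u\in(\ker Q)^\perp,\ \|u\|=1\}$; $\gamma(Q)>0$ is equivalent to $\operatorname{ran}(Q)$ being closed. The iteration is terminated as soon as $r^{(n)}=0$, in which case the sequence is regarded as constant from then on ($u^{(m)}=u^{(n)}$ for $m\ge n$). *)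

(* Defs.v *)
From HB Require Import structures.
From mathcomp Require Import all_boot all_order all_algebra sesquilinear.
From mathcomp Require Import all_classical all_reals all_analysis.
From mathcomp Require Import complex.

Set Implicit Arguments.
Unset Strict Implicit.
Unset Printing Implicit Defensive.

Import Order.TTheory GRing.Theory Num.Theory.
Import numFieldNormedType.Exports.

Local Open Scope classical_set_scope.
Local Open Scope ring_scope.

(* One development for real and complex Hilbert spaces: the statement quantifies
   over the kind of scalars. *)
Variant scalar_kind := RealScalars | ComplexScalars.

Definition scalar (R : realType) (k : scalar_kind) : numFieldType :=
  match k with RealScalars => R : numFieldType | ComplexScalars => R[i] end.

Definition scalar_conj (R : realType) (k : scalar_kind) :
    scalar R k -> scalar R k :=
  match k with RealScalars => idfun | ComplexScalars => @conjc R end.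

Definition scalar_re (R : realType) (k : scalar_kind) : scalar R k -> R :=
  match k with RealScalars => idfun | ComplexScalars => @complex.Re R end.

(* The inner product is linear on the left and conjugate-linear on the right. *)
HB.mixin Record isHilbert (R : realType) (k : scalar_kind) (U : Type)
    of CompleteNormedModule (scalar R k) U := {
  inner : {dot U for @scalar_conj R k};
  inner_norm : forall u : U, `|u| ^+ 2 = inner u u
}.

#[short(type="hilbertType")]
HB.structure Definition Hilbert (R : realType) (k : scalar_kind) :=
  {U of isHilbert R k U & CompleteNormedModule (scalar R k) U}.

(* In a normed module over K the norm `|u| is an element of K, so it may be
   complex-typed; rnorm is the same number as an element of R. *)
Definition rnorm (R : realType) (k : scalar_kind) (U : hilbertType R k)
  (u : U) : R := scalar_re `|u|.

Section Operators.
Variables (R : realType) (k : scalar_kind) (U V : hilbertType R k).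
Implicit Types (Q : {linear U -> V}) (S : set U) (u : U) (v w : V).

Definition bounded_operator Q := exists C : R, forall u,
  rnorm (Q u) <= C * rnorm u.

Definition opnorm Q : R := sup [set rnorm (Q u) | u in [set u | rnorm u <= 1]].

(* By Riesz representation the set is a singleton when Q is bounded. *)
Definition adjoint Q (v : V) : U :=
  get [set x : U | forall u, inner (Q u) v = inner u x].

Definition orthocomplement S : set U :=
  [set u | forall s, S s -> inner u s = 0].

Definition kernel Q : set U := [set u | Q u = 0].

(* Extended-real valued: the infimum is over the empty set, and hence +oo,
   when Q = 0. *)
Definition reduced_min_modulus Q : \bar R :=
  ereal_inf [set (rnorm (Q u))%:E | u in
    [set u | orthocomplement (kernel Q) u /\ rnorm u = 1]].

(* With the library's convention +oo^-1 = 0, this is 0 when Q = 0. *)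
Definition kappa Q : R := fine ((opnorm Q)%:E / reduced_min_modulus Q)%E.

Definition least_squares_solutions Q w : set U :=
  [set u | rnorm (Q u - w) = inf (range (fun u' : U => rnorm (Q u' - w)))].

(* For a nonempty closed affine subspace S the set is a singleton. *)
Definition orthogonal_projection S u : U :=
  get [set p : U | S p /\ forall s, S s -> inner (u - p) (s - p) = 0].

Definition residual Q w u : U := adjoint Q (Q u - w).

Definition steepest_descent_step Q w u : U :=
  let r := residual Q w u in
  if r == 0 then u else u - (`|r| ^+ 2 / `|Q r| ^+ 2) *: r.

End Operators.

(* Main.v *)
(* Let p be the projection of u(0) onto the least squares solutions, e = u - p
   and r = Q^*Qe, the residual. All errors lie in W = (ker Q)^perp, and the step
   length is the exact line search for t |-> |Q(e - t r)|^2, hence at least as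
   good as the fixed step t = 2/(L^2 + g^2) with L = |Q| and g = gamma(Q). On
   ran Q the operator K = QQ^* satisfies g^2 <= K <= L^2, so that
   (K - g^2)(L^2 - K) >= 0, which makes |Qe| contract by the factor
   (L^2 - g^2)/(L^2 + g^2) = 1 - 2/(kappa^2 + 1). On W, g|e| <= |Qe| <= L|e|.
   Adjoints, orthogonal projections and least squares solutions are all obtained
   by minimizing b(x, x) - 2 phi(x) for a coercive symmetric form b. *)

Require Import Defs.
From HB Require Import structures.
From mathcomp Require Import all_boot all_order all_algebra sesquilinear.
From mathcomp Require Import all_classical all_reals all_analysis.
From mathcomp Require Import complex ring lra.

Set Implicit Arguments.
Unset Strict Implicit.
Unset Printing Implicit Defensive.

Import Order.TTheory GRing.Theory Num.Theory.
Import numFieldNormedType.Exports.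

Local Open Scope classical_set_scope.
Local Open Scope ring_scope.

(** * Real numbers inside the real or complex scalars *)

Section Scalars.
Variables (R : realType) (k : scalar_kind).
Implicit Types (c : R) (z : Defs.scalar R k).

(** Through this embedding every space is also a real vector space. The variational arguments run
    there, once for both kinds of scalars. *)
Definition real_scalar c : Defs.scalar R k :=
  match k return Defs.scalar R k with
  | RealScalars => c | ComplexScalars => real_complex R c end.

Lemma scalar_reD z1 z2 : scalar_re (z1 + z2) = scalar_re z1 + scalar_re z2.
Proof. by case: k z1 z2 => //= -[a b] [c d]. Qed.

Lemma scalar_re_real c z : scalar_re (real_scalar c * z) = c * scalar_re z.
Proof.
rewrite /real_scalar; case: k z => //= -[a b] /=.
by rewrite mul0r subr0.
Qed.

Lemma real_scalarK c : scalar_re (real_scalar c) = c.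
Proof. by rewrite /real_scalar; case: k. Qed.

Lemma scalar_re_conj z : scalar_re (scalar_conj z) = scalar_re z.
Proof. by case: k z => //= -[a b]. Qed.

Lemma real_scalarM c1 c2 :
  real_scalar (c1 * c2) = real_scalar c1 * real_scalar c2.
Proof. by rewrite /real_scalar; case: k => //; rewrite rmorphM. Qed.

Lemma real_scalarV c : real_scalar c^-1 = (real_scalar c)^-1.
Proof. by rewrite /real_scalar; case: k => //; rewrite fmorphV. Qed.

Lemma real_scalar1 : real_scalar 1 = 1.
Proof. by rewrite /real_scalar; case: k. Qed.

Lemma real_scalarN c : real_scalar (- c) = - real_scalar c.
Proof. by rewrite /real_scalar; case: k => //; rewrite rmorphN. Qed.

Lemma real_scalar_lt c1 c2 : (real_scalar c1 < real_scalar c2) = (c1 < c2).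
Proof. by rewrite /real_scalar; case: k => //; rewrite ltcR. Qed.

Lemma norm_real_scalar c : `|real_scalar c| = real_scalar `|c|.
Proof.
rewrite /real_scalar; case: k => //.
by rewrite normc_def /= expr0n addr0 sqrtr_sqr.
Qed.

Lemma scalar_reK z : 0 <= z -> real_scalar (scalar_re z) = z.
Proof.
rewrite /real_scalar; case: k z => //= z z0.
by rewrite RRe_real // ger0_real.
Qed.

Lemma scalar_re_ge0 z : 0 <= z -> 0 <= scalar_re z.
Proof. by case: k z => //= z; rewrite lecE => /andP[]. Qed.

(** Taking a = 1 compares the real parts and, over the complex numbers, a = i compares the imaginary
    parts. This lifts identities from [rdot] back to [inner]. *)
Lemma scalar_re_inj z1 z2 :
  (forall a, scalar_re (a * z1) = scalar_re (a * z2)) -> z1 = z2.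
Proof.
case: k z1 z2 => [z1 z2 /(_ 1)|[a b] [c d] H] /=; first by rewrite !mul1r.
have /= := H 'i%C; have /= := H 1.
by rewrite !mul0r !mul1r !subr0 !sub0r => -> /oppr_inj ->.
Qed.

End Scalars.

(** * The underlying real inner product *)

Section RealInnerProduct.
Variables (R : realType) (k : scalar_kind) (U : hilbertType R k).
Implicit Types (c : R) (x y z : U).

Definition rdot x y : R := scalar_re (inner x y).

Lemma rdotDl x y z : rdot (x + y) z = rdot x z + rdot y z.
Proof. by rewrite /rdot linearDl /= scalar_reD. Qed.

Lemma rdotC x y : rdot x y = rdot y x.
Proof.
by rewrite /rdot (hermitian_subproof (s := inner)) expr0 mul1r scalar_re_conj.
Qed.

Lemma rdotDr x y z : rdot x (y + z) = rdot x y + rdot x z.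
Proof. by rewrite rdotC rdotDl !(rdotC _ x). Qed.

Lemma rdotZl c x y : rdot (real_scalar k c *: x) y = c * rdot x y.
Proof. by rewrite /rdot linearZl_LR /= scalar_re_real. Qed.

Lemma rdotZr c x y : rdot x (real_scalar k c *: y) = c * rdot x y.
Proof. by rewrite rdotC rdotZl rdotC. Qed.

Lemma rdotNl x y : rdot (- x) y = - rdot x y.
Proof. by rewrite -scaleN1r -(real_scalar1 R) -real_scalarN rdotZl mulN1r. Qed.

Lemma rdotNr x y : rdot x (- y) = - rdot x y.
Proof. by rewrite rdotC rdotNl rdotC. Qed.

Lemma rnormK x : real_scalar k (rnorm x) = `|x|.
Proof. by rewrite scalar_reK. Qed.

Lemma rnorm_ge0 x : 0 <= rnorm x.
Proof. exact: scalar_re_ge0. Qed.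

Lemma rdotxx x : rdot x x = rnorm x ^+ 2.
Proof.
rewrite /rdot -inner_norm -rnormK !expr2 -real_scalarM; exact: real_scalarK.
Qed.

Lemma rdot_ge0 x : 0 <= rdot x x.
Proof. by rewrite rdotxx sqr_ge0. Qed.

Lemma rnorm_eq0 x : (rnorm x == 0) = (x == 0).
Proof.
apply/eqP/eqP => [x0|->]; last by rewrite /rnorm normr0; case: (k).
apply/eqP; rewrite -normr_eq0 -rnormK x0 /real_scalar.
by case: (k) => /=; rewrite eqxx.
Qed.

Lemma rnorm0 : rnorm (0 : U) = 0.
Proof. by apply/eqP; rewrite rnorm_eq0. Qed.

Lemma rdot0l x : rdot 0 x = 0.
Proof. by rewrite -(scaler0 _ (real_scalar k 0)) rdotZl mul0r. Qed.

Lemma rdot0r x : rdot x 0 = 0.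
Proof. by rewrite rdotC rdot0l. Qed.

Lemma rnormZ c x : rnorm (real_scalar k c *: x) = `|c| * rnorm x.
Proof.
by rewrite /rnorm normrZ norm_real_scalar scalar_re_real.
Qed.

End RealInnerProduct.

(** * Two facts on real numbers: first variation and vanishing error *)

(** This is the first-order condition at a minimum. Any M > 0 with B <= M gives, at t = - d / M, a
    value of at most - d^2 / M. *)
Lemma quadratic_ge0_eq0 (R : realType) (d B : R) :
  (forall t, 0 <= 2 * t * d + t ^+ 2 * B) -> d = 0.
Proof.
move=> H; set M := `|B| + 1.
have M0 : 0 < M by rewrite /M ltr_wpDl.
have BM : B <= M by rewrite /M ler_wpDr // ler_norm.
apply/eqP; rewrite -sqrf_eq0 eq_le sqr_ge0 andbT.
have tM : d / M * M = d by rewrite divfK // gt_eqF.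
have := H (- (d / M)); set t := d / M in tM *.
rewrite sqrrN => H1.
have t2 : 0 <= t ^+ 2 by exact: sqr_ge0.
have : t ^+ 2 * B <= t ^+ 2 * M by rewrite ler_wpM2l.
move=> t2B; have t2M : t ^+ 2 * M <= 0 by rewrite -tM in H1; lra.
by rewrite -tM exprMn [M ^+ 2]expr2 mulrA pmulr_lle0.
Qed.

Lemma infinitesimal_lower_bound (R : realType) (z A : R) :
  (forall e, 0 < e -> - (e * A) <= z) -> 0 <= z.
Proof.
move=> H; apply/ler_addgt0Pl => e e0.
have A0 : 0 < `|A| + 1 by rewrite ltr_wpDl.
have /H := divr_gt0 e0 A0.
have : e / (`|A| + 1) * A <= e.
  rewrite mulrAC ler_pdivrMr // ler_wpM2l ?ltW //.
  by rewrite (le_lt_trans (ler_norm A)) // ltrDl.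
lra.
Qed.

(** * Cauchy-Schwarz, completeness and minimization of quadratic functionals *)

Section Hilbert.
Variables (R : realType) (k : scalar_kind) (U : hilbertType R k).
Implicit Types (c : R) (x y z : U).

(** Expand the squared norm of |y| x - |x| y, which is nonnegative, and divide by 2 |x| |y|. *)
Lemma rdot_le x y : rdot x y <= rnorm x * rnorm y.
Proof.
have [x0|xN0] := eqVneq x 0.
  rewrite x0 -(scaler0 _ (real_scalar k 0)) rdotZl mul0r.
  by rewrite mulr_ge0 ?rnorm_ge0.
have [y0|yN0] := eqVneq y 0.
  rewrite y0 -(scaler0 _ (real_scalar k 0)) rdotZr mul0r.
  by rewrite mulr_ge0 ?rnorm_ge0.
have a0 : 0 < rnorm x by rewrite lt_def rnorm_eq0 xN0 rnorm_ge0.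
have b0 : 0 < rnorm y by rewrite lt_def rnorm_eq0 yN0 rnorm_ge0.
have := rdot_ge0 (real_scalar k (rnorm y) *: x - real_scalar k (rnorm x) *: y).
rewrite rdotDl !rdotDr !rdotNl !rdotNr !rdotZl !rdotZr (rdotC y x) !rdotxx.
have ab : 0 < rnorm x * rnorm y by rewrite mulr_gt0.
by move=> H; rewrite -(ler_pM2l ab); lra.
Qed.

Lemma normr_rdot_le x y : `|rdot x y| <= rnorm x * rnorm y.
Proof.
rewrite ler_norml rdot_le andbT lerNl -rdotNl.
by rewrite (le_trans (rdot_le _ _)) // /rnorm normrN.
Qed.

(** Completeness of the normed module is stated with tolerances in the scalar field. Positive
    scalars are real, so tolerances can be carried over to R and back. *)
Lemma hilbert_complete (x : nat -> U) :
  (forall e, 0 < e -> exists K, forall m n, (K <= m)%N -> (K <= n)%N ->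
    rnorm (x m - x n) < e) ->
  exists p, forall e, 0 < e -> exists K, forall n, (K <= n)%N ->
    rnorm (x n - p) < e.
Proof.
move=> xC.
have scalar_gt0 (e : Defs.scalar R k) : 0 < e -> 0 < scalar_re e.
  move=> e0; rewrite -(real_scalar_lt k) scalar_reK ?ltW //.
  by rewrite /real_scalar; case: (k) (e) e0.
have /cauchy_cvg /cvg_ex[p xp] : cauchy (x @ \oo).
  apply: cauchy_exP => e e0; have [K HK] := xC _ (scalar_gt0 _ e0).
  exists (x K); exists K => // n /= Kn.
  rewrite -ball_normE /ball_ /= -(scalar_reK (ltW e0)) -rnormK real_scalar_lt.
  exact: HK.
exists p => e e0.
have e'0 : 0 < real_scalar k e.
  suff -> : 0 = real_scalar k 0 by rewrite real_scalar_lt.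
  by rewrite /real_scalar; case: (k).
move/cvgrPdist_lt : xp => /(_ _ e'0)[K _ HK].
exists K => n Kn; rewrite -(real_scalar_lt k) rnormK distrC.
exact: HK.
Qed.

Definition closed_real_subspace (N : set U) :=
  [/\ N 0, forall x y, N x -> N y -> N (x + y),
      forall c x, N x -> N (real_scalar k c *: x) &
      forall p, (forall e, 0 < e -> exists2 x, N x & rnorm (x - p) < e) -> N p].

(** A symmetric Lax-Milgram theorem: p is the limit of a minimizing sequence of J, and the equation
    is the vanishing of the first variation. Coercivity is asked on N alone, so that it applies to
    the form (x, y) |-> [rdot (Q x) (Q y)] on (ker Q)^perp. *)
Lemma coercive_form_representation (N : set U) (b : U -> U -> R)
    (phi : U -> R) (g C D : R) :
  closed_real_subspace N -> 0 < g ->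
  (forall x y, b x y = b y x) ->
  (forall x y z, b (x + y) z = b x z + b y z) ->
  (forall c x y, b (real_scalar k c *: x) y = c * b x y) ->
  (forall x y, `|b x y| <= C * (rnorm x * rnorm y)) ->
  (forall x, N x -> g * rnorm x ^+ 2 <= b x x) ->
  (forall x y, phi (x + y) = phi x + phi y) ->
  (forall c x, phi (real_scalar k c *: x) = c * phi x) ->
  (forall x, `|phi x| <= D * rnorm x) ->
  exists2 p, N p & forall n, N n -> b p n = phi n.
Proof.
move=> [N0 ND NZ Ncl] g0 bC bD bZ bb bg phiD phiZ phib.
have bDr x y z : b x (y + z) = b x y + b x z by rewrite bC bD !(bC _ x).
have bZr c x y : b x (real_scalar k c *: y) = c * b x y by rewrite bC bZ bC.
have bN x y : b (- x) y = - b x y.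
  by rewrite -scaleN1r -(real_scalar1 R) -real_scalarN bZ mulN1r.
have bNr x y : b x (- y) = - b x y by rewrite bC bN bC.
have NN x : N x -> N (- x).
  by move=> /(NZ (- 1)); rewrite real_scalarN real_scalar1 scaleN1r.
(* A minimizing sequence of J on N is Cauchy by the parallelogram identity. *)
pose J x := b x x - 2 * phi x.
(* With s = |x|, J x >= g s^2 - 2 D s >= - D^2 / g, the last step by (g s - D)^2 >= 0. *)
have Jlb : lbound (J @` N) (- (D ^+ 2 / g)).
  move=> _ [x Nx <-]; rewrite /J.
  have h1 := bg _ Nx; have /ler_normlP[_ h2] := phib x.
  have h3 := sqr_ge0 (g * rnorm x - D).
  have gg : g * g^-1 = 1 by rewrite mulfV // gt_eqF.
  rewrite -(ler_pM2l g0) mulrN mulrCA mulfV ?gt_eqF // mulr1.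
  have : g * (g * rnorm x ^+ 2) <= g * b x x by rewrite ler_pM2l.
  have : g * phi x <= g * (D * rnorm x) by rewrite ler_pM2l.
  by move: h3; rewrite sqrrB; lra.
have Jinf : has_inf (J @` N) by split; [exists (J 0), 0|eexists; exact: Jlb].
set m := inf (J @` N).
have mJ x : N x -> m <= J x by move=> Nx; apply: ge_inf; [case: Jinf|exists x].
have Jm e : 0 < e -> exists2 x, N x & J x < m + e.
  by move=> e0; have [_ [x Nx <-]] := inf_adherent e0 Jinf; exists x.
pose d (n : nat) : R := n.+1%:R^-1.
have d0 n : 0 < d n by rewrite invr_gt0.
have /choice[x Hx] : forall n, exists x, N x /\ J x < m + d n.
  by move=> n; have [y] := Jm _ (d0 n); exists y.
(* The midpoint of y and z lies in N, so J is at least m there; b (y - z) (y - z) equals 2 (J y + J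
   z) - 4 J ((y + z) / 2). *)
have parallelogram y z : N y -> N z ->
    g * rnorm (y - z) ^+ 2 <= 2 * (J y + J z - 2 * m).
  move=> Ny Nz; apply: le_trans (bg _ (ND _ _ Ny (NN _ Nz))) _.
  have := mJ _ (NZ 2^-1 _ (ND _ _ Ny Nz)); rewrite /J.
  rewrite !bZ !bZr phiZ phiD !bD !bDr !bN !bNr (bC z y); lra.
have dsmall e : 0 < e -> exists K, forall n, (K <= n)%N -> d n < e.
  move=> e0; exists (Num.truncn e^-1) => n Kn.
  rewrite /d invf_plt ?posrE //.
  apply: lt_le_trans (truncnS_gt _) _; by rewrite ler_nat.
have [p Hp] : exists p, forall e, 0 < e -> exists K, forall n, (K <= n)%N ->
    rnorm (x n - p) < e.
  apply: hilbert_complete => e e0.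
  (* When [d i] and [d j] are below g e^2 / 4, the parallelogram bound 2 (d i + d j) is below g
     e^2. *)
  have ge0 : 0 < g * e ^+ 2 / 4 by rewrite divr_gt0 // mulr_gt0 // exprn_gt0.
  have [K HK] := dsmall _ ge0.
  exists K => i j Ki Kj.
  have [[Ni Ji] [Nj Jj]] := (Hx i, Hx j).
  rewrite -(ltr_pXn2r (n := 2)) ?nnegrE ?rnorm_ge0 ?(ltW e0) // -(ltr_pM2l g0).
  apply: le_lt_trans (parallelogram _ _ Ni Nj) _.
  have := HK _ Ki; have := HK _ Kj; lra.
have Np : N p.
  apply: Ncl => e /Hp[K /(_ _ (leqnn K)) xp].
  by exists (x K) => //; case: (Hx K).
exists p => // n Nn; apply/subr0_eq.
apply: (@quadratic_ge0_eq0 _ _ (b n n)) => t.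
(* The variation is taken at a term y of the sequence near p, not at p itself. Near-minimality of y
   costs e, and replacing b y n by b p n costs at most 2 |t| |C| |n| e. *)
apply: (@infinitesimal_lower_bound _ _ (1 + 2 * `|t| * (`|C| * rnorm n))).
move=> e e0.
have [K1 HK1] := Hp _ e0; have [K2 HK2] := dsmall _ e0.
have {HK1} := HK1 _ (leq_maxl K1 K2); have {HK2} := HK2 _ (leq_maxr K1 K2).
set i := maxn K1 K2; have [Nxi Jxi] := Hx i.
move: (x i) Nxi Jxi => y Ny Jy de yp.
have := mJ _ (ND _ _ Ny (NZ t _ Nn)).
rewrite /J bD !bDr !bZ !bZr phiD phiZ (bC n y) => Jmin.
have yn : `|t * b (y - p) n| <= `|t| * ((`|C| * rnorm n) * e).
  rewrite normrM ler_wpM2l //; apply: le_trans (bb _ _) _.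
  apply: le_trans (_ : `|C| * (rnorm (y - p) * rnorm n) <= _).
    by rewrite ler_wpM2r ?ler_norm // mulr_ge0 ?rnorm_ge0.
  rewrite -mulrA ler_wpM2l // mulrC ler_wpM2l ?rnorm_ge0 //; exact: ltW.
have /ler_normlP[_ yn1] := yn.
move: yn1; rewrite bD bN; move: Jy; rewrite /J; lra.
Qed.

End Hilbert.

(** * Adjoint, kernel and normal equations *)

Section Operator.
Variables (R : realType) (k : scalar_kind) (U V : hilbertType R k).
Variable Q : {linear U -> V}.
Implicit Types (c : R) (x y z : U) (v w : V).

Lemma orthogonal_decomposition (N : set U) x : closed_real_subspace N ->
  exists2 p, N p & forall n, N n -> rdot (x - p) n = 0.
Proof.
move=> HN.
have [p Np Hp] : exists2 p, N p & forall n, N n -> rdot p n = rdot x n.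
  apply: (@coercive_form_representation _ _ _ N _ _ 1 1 (rnorm x)) => //.
  - exact: rdotC.
  - exact: rdotDl.
  - exact: rdotZl.
  - by move=> y z; rewrite mul1r normr_rdot_le.
  - by move=> y _; rewrite mul1r rdotxx.
  - exact: rdotDr.
  - by move=> c y; rewrite rdotZr.
  - exact: normr_rdot_le.
by exists p => // n Nn; rewrite rdotDl rdotNl Hp // subrr.
Qed.

(** S is stable under all scalars, so applying the hypothesis to every a s kills the whole inner
    product and not just its real part. *)
Lemma inner_eq0_complex_subspace (S : set U) u :
  (forall a s, S s -> S (a *: s)) ->
  (forall s, S s -> rdot u s = 0) -> forall s, S s -> inner u s = 0.
Proof.
move=> SZ Su s Ss; rewrite (hermitian_subproof (s := inner)) expr0 mul1r.
suff su0 : inner s u = 0.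
  apply: (etrans (congr1 (@scalar_conj R k) su0)).
  by case: (k) => //=; rewrite oppr0.
apply: scalar_re_inj => a; rewrite -linearZl_LR.
by rewrite -[LHS]/(rdot _ _) rdotC Su ?mulr0; [case: (k) | exact: SZ].
Qed.

Lemma orthocomplement_kernelP u :
  orthocomplement (Defs.kernel Q) u <->
  forall s, Defs.kernel Q s -> rdot u s = 0.
Proof.
split=> [+ s ks|]; first by move=> /(_ _ ks); rewrite /rdot => ->; case: (k).
move=> H; apply: inner_eq0_complex_subspace => // a s.
by rewrite /Defs.kernel /= linearZ /= => ->; rewrite scaler0.
Qed.

Hypothesis bounded_Q : bounded_operator Q.

Lemma bounded_operatorP : exists2 C : R, 0 <= C &
  forall u, rnorm (Q u) <= C * rnorm u.
Proof.
have [C HC] := bounded_Q; exists `|C| => // u.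
by apply: le_trans (HC u) _; rewrite ler_wpM2r ?rnorm_ge0 // ler_norm.
Qed.

(** Riesz representation of u |-> [rdot (Q u) v] gives a candidate for the real inner product;
    linearity of Q over the full scalar field upgrades it to [inner]. *)
Lemma adjointP u v : inner (Q u) v = inner u (adjoint Q v).
Proof.
have [C C0 HC] := bounded_operatorP.
have [p _ Hp] : exists2 p, [set: U] p & forall n, [set: U] n ->
    rdot p n = rdot (Q n) v.
  apply: (@coercive_form_representation _ _ _ _ _ _ 1 1 (C * rnorm v)) => //.
  - exact: rdotC.
  - exact: rdotDl.
  - exact: rdotZl.
  - by move=> y z; rewrite mul1r normr_rdot_le.
  - by move=> y _; rewrite mul1r rdotxx.
  - by move=> y z; rewrite linearD rdotDl.
  - by move=> c y; rewrite linearZ /= rdotZl.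
  - move=> y; apply: le_trans (normr_rdot_le _ _) _.
    by rewrite mulrAC ler_wpM2r ?rnorm_ge0.
move: u; apply: (@getPex U [set x | forall u, inner (Q u) v = inner u x]).
exists p => u; apply: scalar_re_inj => a.
by rewrite -!linearZl_LR -linearZ -![scalar_re _]/(rdot _ _) -Hp // rdotC.
Qed.

Lemma rdot_adjoint x v : rdot x (adjoint Q v) = rdot (Q x) v.
Proof. by rewrite /rdot adjointP. Qed.

Lemma kernel_closed_real_subspace : closed_real_subspace (Defs.kernel Q).
Proof.
rewrite /Defs.kernel; split=> /=.
- by rewrite linear0.
- by move=> x y Qx Qy; rewrite linearD Qx Qy addr0.
- by move=> c x Qx; rewrite linearZ /= Qx scaler0.
move=> p Hp; have [C C0 HC] := bounded_operatorP.
apply/eqP; rewrite -rnorm_eq0 eq_le rnorm_ge0 andbT -oppr_ge0.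
apply: (@infinitesimal_lower_bound _ _ C) => e /Hp[x Qx xp].
rewrite lerN2 -[leLHS](_ : rnorm (Q (x - p)) = _); last first.
  by rewrite linearB /= Qx sub0r /rnorm normrN.
by apply: le_trans (HC _) _; rewrite mulrC ler_wpM2r // ltW.
Qed.

Lemma orthocomplement_kernel_closed_real_subspace :
  closed_real_subspace (orthocomplement (Defs.kernel Q)).
Proof.
split.
- apply/orthocomplement_kernelP => s _.
  by rewrite -(scaler0 _ (real_scalar k 0)) rdotZl mul0r.
- move=> x y /orthocomplement_kernelP Wx /orthocomplement_kernelP Wy.
  by apply/orthocomplement_kernelP => s ks; rewrite rdotDl Wx // Wy // addr0.
- move=> c x /orthocomplement_kernelP Wx.
  by apply/orthocomplement_kernelP => s ks; rewrite rdotZl Wx // mulr0.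
move=> p Hp; apply/orthocomplement_kernelP => s ks; apply/eqP.
rewrite -normr_eq0 eq_le normr_ge0 andbT -oppr_ge0.
apply: (@infinitesimal_lower_bound _ _ (rnorm s)) => e.
move=> /Hp[x /orthocomplement_kernelP Wx xp].
rewrite lerN2 -[leLHS](_ : `|rdot (x - p) s| = _); last first.
  by rewrite rdotDl rdotNl Wx // sub0r normrN.
apply: le_trans (normr_rdot_le _ _) _.
by rewrite ler_wpM2r ?rnorm_ge0 // ltW.
Qed.

Lemma kernel_decomposition x :
  exists2 z, Defs.kernel Q z & orthocomplement (Defs.kernel Q) (x - z).
Proof.
have [z kz Hz] := orthogonal_decomposition x kernel_closed_real_subspace.
by exists z => //; apply/orthocomplement_kernelP.
Qed.

(** These are the normal equations. A minimizer satisfies them by varying p along t x; conversely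
    they give Pythagoras for Q x - w = (Q x - Q p) + (Q p - w). *)
Lemma least_squares_solutionsP w p :
  least_squares_solutions Q w p <-> forall x, rdot (Q x) (Q p - w) = 0.
Proof.
have lb : has_lbound (range (fun x => rnorm (Q x - w))).
  by exists 0 => _ [x _ <-]; exact: rnorm_ge0.
rewrite /least_squares_solutions /=; split=> [pmin x|normal].
  apply: (@quadratic_ge0_eq0 _ _ (rdot (Q x) (Q x))) => t.
  have : rnorm (Q p - w) <= rnorm (Q (p + real_scalar k t *: x) - w).
    by rewrite pmin; apply: ge_inf => //; eexists.
  rewrite -(ler_pXn2r (n := 2)) ?nnegrE ?rnorm_ge0 // -!rdotxx.
  rewrite linearD linearZ /=.
  rewrite addrAC; move: (Q p - w) => r.
  rewrite rdotDl !rdotDr !rdotZl !rdotZr (rdotC r (Q x)) -subr_ge0.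
  by congr (_ <= _); ring.
apply/eqP; rewrite eq_le; apply/andP; split; last first.
  by apply: ge_inf => //; exists p.
apply: lb_le_inf; first by exists (rnorm (Q p - w)), p.
move=> _ [x _ <-]; rewrite -(ler_pXn2r (n := 2)) ?nnegrE ?rnorm_ge0 // -!rdotxx.
have := normal (x - p); rewrite linearB /=.
have -> : Q x - w = Q x - Q p + (Q p - w) by rewrite addrA subrK.
move: (Q x - Q p) (Q p - w) => y r yr.
by rewrite (rdotDl y r) !rdotDr (rdotC r y) yr add0r addr0 lerDr rdot_ge0.
Qed.

End Operator.

(** * Reduced minimum modulus and projection onto the least squares solutions *)

Section SteepestDescent.
Variables (R : realType) (k : scalar_kind) (U V : hilbertType R k).
Variable Q : {linear U -> V}.
Implicit Types (c : R) (x y z : U) (v w : V).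
Local Notation W := (orthocomplement (Defs.kernel Q)).

Lemma orthocomplementZ c x : W x -> W (real_scalar k c *: x).
Proof.
move=> /orthocomplement_kernelP Wx; apply/orthocomplement_kernelP => s ks.
by rewrite rdotZl Wx // mulr0.
Qed.

Lemma rnorm_normalized x : x != 0 -> rnorm (real_scalar k (rnorm x)^-1 *: x) = 1.
Proof.
move=> x0; rewrite rnormZ ger0_norm ?invr_ge0 ?rnorm_ge0 // mulVf //.
by rewrite rnorm_eq0.
Qed.

Lemma reduced_min_modulus_le x : W x -> x != 0 ->
  (reduced_min_modulus Q <= (rnorm (Q x) / rnorm x)%:E)%E.
Proof.
move=> Wx x0; apply: ge_ereal_inf.
exists (rnorm (Q (real_scalar k (rnorm x)^-1 *: x)))%:E; last first.
  rewrite lee_fin linearZ /= rnormZ ger0_norm ?invr_ge0 ?rnorm_ge0 //.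
  by rewrite mulrC.
exists (real_scalar k (rnorm x)^-1 *: x) => //.
by split; [exact: orthocomplementZ | exact: rnorm_normalized].
Qed.

Lemma reduced_min_modulus_pinfty x :
  reduced_min_modulus Q = +oo%E -> W x -> x = 0.
Proof.
move=> gy Wx; apply: contrapT => /eqP x0.
by have := reduced_min_modulus_le Wx x0; rewrite gy.
Qed.

Lemma reduced_min_modulus_fin (g : R) x : reduced_min_modulus Q = g%:E ->
  W x -> g * rnorm x <= rnorm (Q x).
Proof.
move=> gE Wx; have [->|x0] := eqVneq x 0.
  by rewrite linear0 !rnorm0 mulr0.
have := reduced_min_modulus_le Wx x0; rewrite gE lee_fin ler_pdivlMr //.
by rewrite lt_def rnorm_eq0 x0 rnorm_ge0.
Qed.

(** Over an empty set the infimum would be +oo. The vector is used to compare g with the operator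
    norm. *)
Lemma reduced_min_modulus_unit_vector (g : R) : reduced_min_modulus Q = g%:E ->
  exists x, W x /\ rnorm x = 1.
Proof.
move=> gE; apply: contrapT => noW.
move: gE; rewrite /reduced_min_modulus (_ : [set _ | _ in _] = set0).
  by rewrite ereal_inf0.
by rewrite -subset0 => r [x Wx _]; apply: noW; exists x.
Qed.

Lemma coercive_on_orthocomplement : (0 < reduced_min_modulus Q)%E ->
  exists2 g : R, 0 < g & forall x, W x -> g * rnorm x <= rnorm (Q x).
Proof.
case gE : (reduced_min_modulus Q) => [g| |] // g0.
  by exists g => [|x]; [rewrite -lte_fin | exact: reduced_min_modulus_fin].
(* The infimum is +oo, so W contains only 0 and any positive constant would do. *)
exists 1 => // x Wx.
by rewrite (reduced_min_modulus_pinfty gE Wx) linear0 !rnorm0 mulr0.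
Qed.

Hypothesis bounded_Q : bounded_operator Q.

Lemma rnorm_le_opnorm x : rnorm (Q x) <= opnorm Q * rnorm x.
Proof.
have [->|x0] := eqVneq x 0; first by rewrite linear0 !rnorm0 mulr0.
have nx : 0 < rnorm x by rewrite lt_def rnorm_eq0 x0 rnorm_ge0.
rewrite -ler_pdivrMr //.
apply: ub_le_sup; last first.
  exists (real_scalar k (rnorm x)^-1 *: x) => /=; first by rewrite rnorm_normalized.
  by rewrite linearZ /= rnormZ ger0_norm ?invr_ge0 ?rnorm_ge0 // mulrC.
have [C C0 HC] := bounded_operatorP bounded_Q.
exists C => _ [y /= y1 <-]; apply: le_trans (HC _) _.
by rewrite -[leRHS]mulr1 ler_wpM2l.
Qed.

(** First solve the normal equations within W, where the form is coercive with constant g^2; then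
    add the kernel component of x - p. Solutions differ by elements of ker Q, so this is the
    projection. *)
Lemma least_squares_projectionP w x :
  (0 < reduced_min_modulus Q)%E ->
  let S := least_squares_solutions Q w in
  S (orthogonal_projection S x) /\
  forall s, S s ->
    inner (x - orthogonal_projection S x) (s - orthogonal_projection S x) = 0.
Proof.
move=> /coercive_on_orthocomplement[g g0 gW] S.
rewrite /orthogonal_projection.
apply: (@getPex U [set p | S p /\ forall s, S s -> inner (x - p) (s - p) = 0]).
have [C C0 HC] := bounded_operatorP bounded_Q.
have [p Wp Hp] : exists2 p, W p &
    forall n, W n -> rdot (Q p) (Q n) = rdot w (Q n).
  apply: (@coercive_form_representation _ _ _ W (fun p n => rdot (Q p) (Q n))
    _ (g ^+ 2) (C ^+ 2) (rnorm w * C)).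
  - exact: orthocomplement_kernel_closed_real_subspace.
  - by rewrite exprn_gt0.
  - by move=> *; rewrite rdotC.
  - by move=> *; rewrite linearD rdotDl.
  - by move=> *; rewrite linearZ /= rdotZl.
  - move=> y z; apply: le_trans (normr_rdot_le _ _) _.
    by rewrite expr2 mulrACA ler_pM ?rnorm_ge0.
  - move=> y /gW; rewrite rdotxx -exprMn => gy.
    by rewrite ler_pXn2r ?nnegrE ?rnorm_ge0 // mulr_ge0 ?rnorm_ge0 // ltW.
  - by move=> *; rewrite linearD rdotDr.
  - by move=> *; rewrite linearZ /= rdotZr.
  - move=> y; apply: le_trans (normr_rdot_le _ _) _.
    by rewrite -mulrA ler_wpM2l ?rnorm_ge0.
(* Equations tested against W hold against every y, because Q kills the kernel component of y. *)
have normal z q : Defs.kernel Q z -> q = p + z ->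
    forall y, rdot (Q y) (Q q - w) = 0.
  move=> kz -> y; have [y' ky' Wy] := kernel_decomposition bounded_Q y.
  rewrite linearD kz addr0 -(subrK y' y) linearD ky' addr0 rdotDr rdotNr.
  by rewrite rdotC Hp // rdotC subrr.
have [z kz Wz] := kernel_decomposition bounded_Q (x - p).
exists (p + z); split.
  by apply/least_squares_solutionsP; exact: (normal z).
move=> s /least_squares_solutionsP Ss.
have -> : x - (p + z) = x - p - z by rewrite opprD addrA.
apply: Wz.
(* Q s - Q (p + z) is a difference of two vectors orthogonal to ran Q and itself lies in ran Q,
   hence vanishes. *)
rewrite /Defs.kernel /= linearB; apply/eqP.
rewrite -rnorm_eq0 -sqrf_eq0 -rdotxx.
rewrite -linearB -[X in rdot _ X](_ : Q s - w - (Q (p + z) - w) = _); last first.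
  by rewrite opprB addrA subrK linearB.
by rewrite rdotDr rdotNr Ss (normal z) // subrr.
Qed.

End SteepestDescent.

(** * Spectral bounds and contraction in one step *)

Section Contraction.
Variables (R : realType) (k : scalar_kind) (U V : hilbertType R k).
Variable Q : {linear U -> V}.
Implicit Types (c : R) (x y z : U) (v w : V).
Local Notation W := (orthocomplement (Defs.kernel Q)).
Hypothesis bounded_Q : bounded_operator Q.
Local Notation S x := (adjoint Q (Q x)).

Lemma rdot_inj x y : (forall z, rdot z x = rdot z y) -> x = y.
Proof.
move=> xy; apply/eqP; rewrite -subr_eq0 -rnorm_eq0 -sqrf_eq0 -rdotxx.
by rewrite rdotDr rdotNr xy subrr.
Qed.

Lemma adjoint_orthocomplement v : W (adjoint Q v).
Proof.
apply/orthocomplement_kernelP => s ks.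
by rewrite rdotC rdot_adjoint // ks rdot0l.
Qed.

(** By Cauchy-Schwarz, g |Qx|^2 = g <x, Sx> <= g |x| |Sx| <= |Qx| |Sx|; then cancel |Qx|. *)
Lemma rnorm_normal_ge (g : R) x : 0 < g ->
  (forall y, W y -> g * rnorm y <= rnorm (Q y)) -> W x ->
  g ^+ 2 * rnorm (Q x) ^+ 2 <= rnorm (S x) ^+ 2.
Proof.
move=> g0 gW Wx; rewrite -exprMn.
rewrite ler_pXn2r ?nnegrE ?mulr_ge0 ?rnorm_ge0 ?(ltW g0) //.
have [->|Qx0] := eqVneq (rnorm (Q x)) 0; first by rewrite mulr0 rnorm_ge0.
have Qx : 0 < rnorm (Q x) by rewrite lt_def Qx0 rnorm_ge0.
rewrite -(ler_pM2l Qx) mulrCA -expr2 -rdotxx -rdot_adjoint //.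
apply: le_trans (_ : g * (rnorm x * rnorm (S x)) <= _).
  by rewrite ler_pM2l // rdot_le.
by rewrite mulrA ler_wpM2r ?rnorm_ge0 // gW.
Qed.

(** By Cauchy-Schwarz, |Sx|^2 = <QSx, Qx> <= L |Sx| |Qx|; then cancel |Sx|. *)
Lemma rnorm_normal_le (L : R) x : 0 <= L ->
  (forall y, rnorm (Q y) <= L * rnorm y) ->
  rnorm (S x) ^+ 2 <= L ^+ 2 * rnorm (Q x) ^+ 2.
Proof.
move=> L0 QL; rewrite -exprMn ler_pXn2r ?nnegrE ?mulr_ge0 ?rnorm_ge0 //.
have [->|Sx0] := eqVneq (rnorm (S x)) 0; first by rewrite mulr_ge0 // rnorm_ge0.
have Sx : 0 < rnorm (S x) by rewrite lt_def Sx0 rnorm_ge0.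
rewrite -(ler_pM2l Sx) -expr2 -rdotxx rdot_adjoint //.
apply: le_trans (rdot_le _ _) _; rewrite mulrA ler_wpM2r ?rnorm_ge0 //.
by rewrite mulrC QL.
Qed.

(** With y = Qx the claim is <(K - G)(L2 - K) y, y> >= 0. For the commuting self-adjoint A = K - G
    and B = M - K, the identity <A By, By> + <B Ay, Ay> = (M - G) <AB y, y> reduces it to the two
    given bounds. *)
Lemma normal_operator_quadratic (G L2 : R) x : G <= L2 ->
  (forall y, W y -> G * rnorm (Q y) ^+ 2 <= rnorm (S y) ^+ 2) ->
  (forall y, rnorm (S y) ^+ 2 <= L2 * rnorm (Q y) ^+ 2) ->
  W x ->
  L2 * G * rnorm (Q x) ^+ 2 + rnorm (Q (S x)) ^+ 2
    <= (L2 + G) * rnorm (S x) ^+ 2.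
Proof.
move=> GL lo up Wx; rewrite -subr_ge0.
(* Enlarging L2 by e allows division by M - G even if G = L2; the claim then changes by e times the
   quantity given here. *)
apply: (@infinitesimal_lower_bound _ _
  (rnorm (S x) ^+ 2 - G * rnorm (Q x) ^+ 2)) => e e0.
set M := L2 + e.
(* With M > L2, the conclusion for M is (M - G)^-1 times the sum of the lower
   bound at M x - r and the upper bound at G x - r. *)
have upM y : rnorm (S y) ^+ 2 <= M * rnorm (Q y) ^+ 2.
  by apply: le_trans (up _) _; rewrite ler_wpM2r ?sqr_ge0 // lerDl ltW.
have MG : 0 < M - G by rewrite /M; lra.
pose r := S x.
have Wr : W r by exact: adjoint_orthocomplement.
have HW : W (real_scalar k M *: x + (- r)).
  have [_ WD WZ _] := orthocomplement_kernel_closed_real_subspace Q.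
  apply: WD; first exact: WZ.
  by rewrite -scaleN1r -(real_scalar1 R) -real_scalarN; exact: WZ.
have SE c : S (real_scalar k c *: x - r) = real_scalar k c *: r - S r.
  apply: rdot_inj => z; rewrite rdot_adjoint // linearB linearZ /=.
  by rewrite !rdotDr !rdotNr !rdotZr !rdot_adjoint.
have Sq c : rnorm (S (real_scalar k c *: x - r)) ^+ 2 =
    c ^+ 2 * rnorm r ^+ 2 - 2 * c * rnorm (Q r) ^+ 2 + rnorm (S r) ^+ 2.
  rewrite SE -!rdotxx rdotDl !rdotDr !rdotNl !rdotNr !rdotZl !rdotZr.
  by rewrite (rdotC (S r) r) (rdot_adjoint bounded_Q r (Q r)); ring.
have Qq c : rnorm (Q (real_scalar k c *: x - r)) ^+ 2 =
    c ^+ 2 * rnorm (Q x) ^+ 2 - 2 * c * rnorm r ^+ 2 + rnorm (Q r) ^+ 2.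
  rewrite linearB linearZ /= -!rdotxx.
  rewrite rdotDl !rdotDr !rdotNl !rdotNr !rdotZl !rdotZr (rdotC (Q x) (Q r)).
  by rewrite -(rdot_adjoint bounded_Q r (Q x)) -/r; ring.
have := upM (real_scalar k G *: x - r); have := lo _ HW.
rewrite !Sq !Qq => h1 h2; rewrite -/r -subr_ge0 -(pmulr_rge0 _ MG).
by rewrite /M in h1 h2 *; lra.
Qed.

(** Write a, b, c for the squares of |Qx|, |r|, |Qr|. The line search leaves a - b^2 / c, and a
    Kantorovich-type inequality bounds b^2 / c below by 4 L2 G a / (L2 + G)^2. *)
Lemma optimal_step_contraction (G L2 : R) x :
  0 < G -> G <= L2 ->
  (forall y, W y -> G * rnorm (Q y) ^+ 2 <= rnorm (S y) ^+ 2) ->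
  (forall y, rnorm (S y) ^+ 2 <= L2 * rnorm (Q y) ^+ 2) ->
  W x -> 0 < rnorm (Q (S x)) ->
  rnorm (Q (x - real_scalar k (rnorm (S x) ^+ 2 / rnorm (Q (S x)) ^+ 2) *: S x))
    ^+ 2 <= ((L2 - G) / (L2 + G)) ^+ 2 * rnorm (Q x) ^+ 2.
Proof.
move=> G0 GL lo up Wx Qr0.
have := normal_operator_quadratic GL lo up Wx; set r := S x.
set t := rnorm r ^+ 2 / rnorm (Q r) ^+ 2.
have -> : rnorm (Q (x - real_scalar k t *: r)) ^+ 2 =
    rnorm (Q x) ^+ 2 - 2 * t * rnorm r ^+ 2 + t ^+ 2 * rnorm (Q r) ^+ 2.
  rewrite linearB linearZ /= -!rdotxx.
  rewrite rdotDl !rdotDr !rdotNl !rdotNr !rdotZl !rdotZr (rdotC (Q x) (Q r)).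
  by rewrite -(rdot_adjoint bounded_Q r (Q x)) -/r; ring.
have c0 : 0 < rnorm (Q r) ^+ 2 by rewrite exprn_gt0.
have a0 : 0 <= rnorm (Q x) ^+ 2 by exact: sqr_ge0.
rewrite /t; move: (rnorm (Q r) ^+ 2) c0 (rnorm r ^+ 2) (rnorm (Q x) ^+ 2) a0.
move=> {t} c c0 b a a0 abc.
have M0 : 0 < L2 + G by rewrite ltr_wpDl ?(le_trans (ltW G0)).
have -> : a - 2 * (b / c) * b + (b / c) ^+ 2 * c = a - b ^+ 2 / c.
  by field; rewrite gt_eqF.
rewrite expr_div_n [leRHS]mulrAC ler_pdivlMr ?exprn_gt0 // -(ler_pM2r c0).
have -> : (a - b ^+ 2 / c) * (L2 + G) ^+ 2 * c =
    a * c * (L2 + G) ^+ 2 - ((L2 + G) * b) ^+ 2.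
  by field; rewrite gt_eqF.
have : (L2 * G * a + c) ^+ 2 <= ((L2 + G) * b) ^+ 2.
  have ac0 : 0 <= L2 * G * a + c.
    by rewrite addr_ge0 ?(ltW c0) // !mulr_ge0 ?(ltW G0) // (le_trans (ltW G0)).
  by rewrite ler_pXn2r ?nnegrE // (le_trans ac0).
(* This is the arithmetic-geometric mean inequality 4 L2 G a c <= (L2 G a + c)^2. *)
have := sqr_ge0 (L2 * G * a - c); lra.
Qed.
End Contraction.

(** * The recurrence for the error *)

Section Iteration.
Variables (R : realType) (k : scalar_kind) (U V : hilbertType R k).
Variable Q : {linear U -> V}.
Implicit Types (c : R) (x y z : U) (v w : V).
Local Notation W := (orthocomplement (Defs.kernel Q)).
Hypothesis bounded_Q : bounded_operator Q.

Lemma residual_error w p y : least_squares_solutions Q w p ->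
  residual Q w y = adjoint Q (Q (y - p)).
Proof.
move=> /least_squares_solutionsP normal; apply: rdot_inj => z.
rewrite !rdot_adjoint // linearB -[in LHS](subrK (Q p) (Q y)) -addrA rdotDr.
by rewrite normal addr0.
Qed.

Lemma steepest_descent_error w p y : least_squares_solutions Q w p ->
  let e := y - p in let r := adjoint Q (Q e) in
  steepest_descent_step Q w y - p =
    e - real_scalar k (rnorm r ^+ 2 / rnorm (Q r) ^+ 2) *: r.
Proof.
move=> pS e r; rewrite /steepest_descent_step (residual_error _ pS) -/e -/r.
(* In the terminated case the formula subtracts a multiple of 0, so it agrees with the stopped
   iteration. *)
have [->|_] := eqVneq r 0; first by rewrite scaler0 subr0.
by rewrite !expr2 !(real_scalarM, real_scalarV) !rnormK addrAC.
Qed.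

(** Adding a kernel element z to p gives another least squares solution, so z is an admissible
    direction in the projection property. *)
Lemma projection_error_orthogonal w p x : least_squares_solutions Q w p ->
  (forall s, least_squares_solutions Q w s -> inner (x - p) (s - p) = 0) ->
  W (x - p).
Proof.
move=> pS Hp z kz; have := Hp (p + z); rewrite [p + z - p]addrAC subrr add0r.
by apply; rewrite /least_squares_solutions /= linearD kz addr0.
Qed.

End Iteration.

(** * The error estimate *)

Theorem corollary6p7 (R : realType) (k : scalar_kind)
    (U V : hilbertType R k) (Q : {linear U -> V})
    (bounded_Q : bounded_operator Q)
    (gamma_gt0 : (0 < reduced_min_modulus Q)%E)
    (w : V) (u : nat -> U)
    (descent : forall n, u n.+1 = steepest_descent_step Q w (u n)) :
  let e n := u n - orthogonal_projection (least_squares_solutions Q w) (u 0%N) in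
  forall n, rnorm (e n) <=
    kappa Q * (1 - 2 / (kappa Q ^+ 2 + 1)) ^+ n * rnorm (e 0%N).
Proof.
have [] := least_squares_projectionP bounded_Q w (u 0%N) gamma_gt0.
set p := orthogonal_projection _ _ => pS Hp e.
have [_ WD WZ _] := orthocomplement_kernel_closed_real_subspace Q.
have eW n : orthocomplement (Defs.kernel Q) (e n).
  elim: n => [|n IHn]; first exact: projection_error_orthogonal pS Hp.
  rewrite /e descent (steepest_descent_error bounded_Q _ pS).
  apply: WD => //; rewrite -scaleN1r -(real_scalar1 R) -real_scalarN.
  by apply/WZ/WZ; exact: adjoint_orthocomplement.
(* Here W is trivial and all errors vanish, whatever value [kappa] takes. *)
have [gE|] := eqVneq (reduced_min_modulus Q) +oo%E.
  move=> n; rewrite (reduced_min_modulus_pinfty gE (eW n)) rnorm0.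
  by rewrite (reduced_min_modulus_pinfty gE (eW 0%N)) rnorm0 mulr0.
case gE : (reduced_min_modulus Q) gamma_gt0 => [g| |] //.
rewrite lte_fin => g0 _; have gW x := reduced_min_modulus_fin (x := x) gE.
have QL := rnorm_le_opnorm bounded_Q.
have gL : g <= opnorm Q.
  have [x [Wx x1]] := reduced_min_modulus_unit_vector gE.
  by have := le_trans (gW _ Wx) (QL x); rewrite x1 !mulr1.
have L0 : 0 < opnorm Q := lt_le_trans g0 gL.
have -> : kappa Q = opnorm Q / g.
  by rewrite /kappa gE inver gt_eqF.
move: (opnorm Q) L0 gL QL => L L0 gL QL.
set q := 1 - _.
have qE : q = (L ^+ 2 - g ^+ 2) / (L ^+ 2 + g ^+ 2).
  rewrite /q; field.
  by rewrite !gt_eqF // ltr_wpDl ?sqr_ge0 ?exprn_gt0.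
have g2L2 : g ^+ 2 <= L ^+ 2 by rewrite ler_pXn2r ?nnegrE ?(ltW g0) ?(ltW L0).
have q0 : 0 <= q.
  by rewrite qE divr_ge0 ?subr_ge0 // addr_ge0 ?sqr_ge0.
have lo x := rnorm_normal_ge (x := x) bounded_Q g0 gW.
have up x := rnorm_normal_le bounded_Q x (ltW L0) QL.
have Qe n : rnorm (Q (e n)) <= q ^+ n * rnorm (Q (e 0%N)).
  elim: n => [|n IHn]; first by rewrite mul1r.
  apply: le_trans (_ : q * rnorm (Q (e n)) <= _); last first.
    by rewrite exprS -mulrA ler_wpM2l.
  rewrite -(ler_pXn2r (n := 2)) ?nnegrE ?mulr_ge0 ?rnorm_ge0 // exprMn.
  rewrite {1}/e descent (steepest_descent_error bounded_Q _ pS) -/(e n) qE.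
  have Wr := adjoint_orthocomplement bounded_Q (Q (e n)).
  (* If the residual vanishes then |Qe|^2 = <e, r> = 0, so both sides are 0; otherwise r is a
     nonzero element of W and |Qr| >= g |r| > 0. *)
  have [r0|r0] := eqVneq (adjoint Q (Q (e n))) 0.
    have Qe0 : rnorm (Q (e n)) = 0.
      by apply/eqP; rewrite -sqrf_eq0 -rdotxx -rdot_adjoint // r0 rdot0r.
    by rewrite r0 scaler0 subr0 Qe0 expr0n mulr0.
  apply: optimal_step_contraction => //; first by rewrite exprn_gt0.
  apply: lt_le_trans (gW _ Wr); rewrite mulr_gt0 //.
  by rewrite lt_def rnorm_eq0 r0 rnorm_ge0.
(* The factor [kappa] = L / g arises from the two norm comparisons: g |e| <= |Qe| at step n, and
   |Qe| <= L |e| at step 0. *)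
move=> n; rewrite -(ler_pM2l g0); apply: le_trans (gW _ (eW n)) _.
apply: le_trans (Qe n) _.
have -> : g * (L / g * q ^+ n * rnorm (e 0%N)) = q ^+ n * (L * rnorm (e 0%N)).
  by field; rewrite gt_eqF.
by rewrite ler_wpM2l // exprn_ge0.
Qed.
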